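(* For every $k\geq2$, the refined $k$-hypergraph skew-symmetric quadratic data $k\text{-}\overline{\mathrm{HG}}=\big(\{k\text{-}\overline{\mathrm{HG}}(n)\}_{n\ge0},\{\circ_p\}\big)$ form an operad in the symmetric monoidal category $(\mathbf{QD}^-,\oplus)$.
   Context: Work over $\mathbb Q$. For a vector space $V$ (in degree $0$), $V^{\wedge2}\subset V^{\otimes2}$ is spanned by $x\wedge y=x\otimes y-y\otimes x$. The category $\mathbf{QD}^-$ of skew-symmetric quadratic data has objects $(V,R)$ with $R\subset V^{\wedge2}$ and morphisms the linear maps $f$ with $f^{\otimes2}(R)\subset S$; its symmetric monoidal product is $(V,R)\oplus(W,S)=(V\oplus W,R\oplus[V,W]_-\oplus S)$, with $[V,W]_-=\langle v\otimes w-w\otimes v\mid v\in V,w\in W\rangle$, and unit $(0,0)$. An operad in $(\mathbf{QD}^-,\oplus)$ is a (symmetric, unital, with partial compositions) operad in this symmetric monoidal category, with components in all arities $n\ge0$; in particular each $\circ_p$ must be a morphism $P(n)\oplus P(m)\to P(n+m-1)$ of quadratic data. Fix $k\ge2$. Let $V(n)$ be the vector space with basis $t^n_I$ indexed by the $k$-element subsets (''hyperedges'') $I\subset\{1,\dots,n\}$ (so $V(n)=0$ for $n<k$). The symmetric group $\mathbb S_n$ acts by permuting the labels. The data are $k\text{-}\overline{\mathrm{HG}}(n)=(V(n),R(n))$, where $R(n)$ is spanned by the $t^n_I\wedge t^n_J$ for hyperedges with $I\cap J=\emptyset$, and by the $t^n_{\{i_1,\dots,i_k\}}\wedge\big(t^n_{J\cup\{i_1\}}+\cdots+t^n_{J\cup\{i_k\}}\big)$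 for every hyperedge $I=\{i_1,\dots,i_k\}$ and every set $J$ of $k-1$ elements of $\{1,\dots,n\}$ disjoint from $I$. For $1\le p\le n$ let $\pi_p:\{1,\dots,n+m-1\}\to\{1,\dots,n\}$ be the monotone map collapsing $\{p,\dots,p+m-1\}$ to $p$ and mapping the remaining elements bijectively and monotonically onto $\{1,\dots,n\}\setminus\{p\}$. The map $\circ_p:V(n)\oplus V(m)\to V(n+m-1)$ is $t^n_I\mapsto\sum t^{n+m-1}_{I'}$, the sum over all $k$-element subsets $I'$ mapped bijectively onto $I$ by $\pi_p$, and $t^m_J\mapsto t^{n+m-1}_{J+p-1}$, where $J+a=\{j+a\mid j\in J\}$. The operadic unit is the zero map $(0,0)\to k\text{-}\overline{\mathrm{HG}}(1)=(0,0)$. *)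

(* Defs.v *)
From HB Require Import structures.
From mathcomp Require Import all_boot fingroup perm all_algebra.
From mathcomp Require Import boolp classical_sets.
From mathcomp Require Import freeg zify generic_quotient.

Set Implicit Arguments.
Unset Strict Implicit.
Unset Printing Implicit Defensive.

Import GRing.Theory.
Local Open Scope quotient_scope.
Local Open Scope ring_scope.
Local Open Scope classical_set_scope.

Definition submodule (M : lmodType rat) (S : set M) : Prop :=
  S 0 /\ forall a x y, S x -> S y -> S (a *: x + y).

Inductive span (M : lmodType rat) (G : set M) : set M :=
| span0 : span G 0
| span_step a g x : G g -> span G x -> span G (a *: g + x).

Section Span.
Variables (M : lmodType rat) (G : set M).

Lemma sub_span : G `<=` span G.
Proof.
by move=> g Gg; rewrite -[g]addr0 -[g]scale1r; apply: span_step => //; apply: span0.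
Qed.

Lemma spanD x y : span G x -> span G y -> span G (x + y).
Proof.
move=> Gx Gy; elim: Gx => [|a g z Gg _ IH]; first by rewrite add0r.
by rewrite -addrA; apply: span_step.
Qed.

Lemma spanZ a x : span G x -> span G (a *: x).
Proof.
elim=> [|b g z Gg _ IH]; first by rewrite scaler0; apply: span0.
by rewrite scalerDr scalerA; apply: span_step.
Qed.

Lemma span_submodule : submodule (span G).
Proof. by split=> [|a x y Gx Gy]; [apply: span0 | apply/spanD/Gy/spanZ]. Qed.

Lemma span_min (S : set M) : submodule S -> G `<=` S -> span G `<=` S.
Proof.
by move=> [S0 SD] GS x; elim=> // a g z Gg _ Sz; apply: SD => //; apply: GS.
Qed.

End Span.

Section QuotientModule.
Variables (M : lmodType rat) (G : set M).

Definition quotmod_rel (x y : M) : bool := `[< span G (x - y) >].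

Lemma quotmod_equiv : equiv_class_of quotmod_rel.
Proof.
split=> [x|x y|y x z]; rewrite /quotmod_rel.
- by apply/asboolP; rewrite subrr; apply: span0.
- by apply/asboolP/asboolP => /(spanZ (-1)); rewrite scaleN1r opprB.
- move=> /asboolP Gxy /asboolP Gyz; apply/asboolP.
  by have := spanD Gxy Gyz; rewrite addrA subrK.
Qed.

Canonical quotmod_equivRel := EquivRelPack quotmod_equiv.

Definition quotmod := {eq_quot quotmod_rel}.

HB.instance Definition _ := EqQuotient.on quotmod.
HB.instance Definition _ := Choice.on quotmod.

Lemma quotmod_eqP (x y : M) :
  \pi_quotmod x = \pi_quotmod y <-> span G (x - y).
Proof. by split=> [/eqmodP/asboolP|?] //; apply/eqmodP/asboolP. Qed.

Lemma quotmod_repr (x : M) : span G (repr (\pi_quotmod x) - x).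
Proof. by apply/quotmod_eqP; rewrite reprK. Qed.

Definition quotmod_zero : quotmod := \pi_quotmod 0.
Definition quotmod_add (x y : quotmod) : quotmod := \pi_quotmod (repr x + repr y).
Definition quotmod_opp (x : quotmod) : quotmod := \pi_quotmod (- repr x).
Definition quotmod_scale (a : rat) (x : quotmod) : quotmod := \pi_quotmod (a *: repr x).

Lemma quotmod_piD x y : quotmod_add (\pi_quotmod x) (\pi_quotmod y) = \pi_quotmod (x + y).
Proof.
apply/quotmod_eqP; rewrite opprD addrACA.
by apply: spanD; apply: quotmod_repr.
Qed.

Lemma quotmod_piZ a x : quotmod_scale a (\pi_quotmod x) = \pi_quotmod (a *: x).
Proof. by apply/quotmod_eqP; rewrite -scalerBr; apply/spanZ/quotmod_repr. Qed.

Lemma quotmod_piN x : quotmod_opp (\pi_quotmod x) = \pi_quotmod (- x).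
Proof.
apply/quotmod_eqP; rewrite -opprD -[X in span G X]scaleN1r.
exact/spanZ/quotmod_repr.
Qed.

Fact quotmod_addA : associative quotmod_add.
Proof.
elim/quotW=> x; elim/quotW=> y; elim/quotW=> z.
by rewrite (quotmod_piD y z) (quotmod_piD x y) 2!quotmod_piD addrA.
Qed.
Fact quotmod_addC : commutative quotmod_add.
Proof.
by elim/quotW=> x; elim/quotW=> y; rewrite (quotmod_piD x y) quotmod_piD addrC.
Qed.
Fact quotmod_add0 : left_id quotmod_zero quotmod_add.
Proof. by elim/quotW=> x; rewrite (quotmod_piD 0 x) add0r. Qed.
Fact quotmod_addN : left_inverse quotmod_zero quotmod_opp quotmod_add.
Proof. by elim/quotW=> x; rewrite (quotmod_piN x) quotmod_piD addNr. Qed.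

HB.instance Definition _ := GRing.isZmodule.Build quotmod
  quotmod_addA quotmod_addC quotmod_add0 quotmod_addN.

Fact quotmod_scaleA a b x :
  quotmod_scale a (quotmod_scale b x) = quotmod_scale (a * b) x.
Proof.
by elim/quotW: x => x; rewrite (quotmod_piZ b x) 2!quotmod_piZ scalerA.
Qed.
Fact quotmod_scale1 : left_id 1 quotmod_scale.
Proof. by elim/quotW=> x; rewrite (quotmod_piZ 1 x) scale1r. Qed.
Fact quotmod_scaleDr : right_distributive quotmod_scale +%R.
Proof.
move=> a; elim/quotW=> x; elim/quotW=> y.
rewrite (quotmod_piZ a x) (quotmod_piZ a y) [RHS]quotmod_piD.
by rewrite [X in quotmod_scale a X](quotmod_piD x y) (quotmod_piZ a (x + y)) scalerDr.
Qed.
Fact quotmod_scaleDl x : {morph quotmod_scale^~ x : a b / a + b}.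
Proof.
move=> a b; elim/quotW: x => x.
rewrite (quotmod_piZ (a + b) x) (quotmod_piZ a x) (quotmod_piZ b x).
by rewrite [RHS]quotmod_piD scalerDl.
Qed.

HB.instance Definition _ := GRing.Zmodule_isLmodule.Build rat quotmod
  quotmod_scaleA quotmod_scale1 quotmod_scaleDr quotmod_scaleDl.

Fact quotmod_pi_linear : linear (fun x : M => \pi_quotmod x).
Proof.
move=> a x y; rewrite -(quotmod_piD (a *: x) y).
by congr quotmod_add; rewrite -quotmod_piZ.
Qed.

End QuotientModule.

Lemma quotmod_piP (M : lmodType rat) (G : set M) (x : quotmod G) :
  \pi_(quotmod G) (repr x) = x.
Proof. exact: reprK. Qed.

Section FreeModule.
Variables (T : choiceType) (M : lmodType rat) (f : T -> M).

Lemma fglift_linear : linear (fglift f : {freeg T / rat} -> M).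
Proof.
have fB : zmod_morphism (fglift f : {freeg T / rat} -> M).
  exact: lift_is_additive.
pose F := HB.pack_for {additive {freeg T / rat} -> M} (fglift f)
  (GRing.isZmodMorphism.Build _ _ _ fB).
have FE D : F D = \sum_(p <- dom D) coeff p D *: f p.
  rewrite -[D in LHS]freeg_sumE raddf_sum.
  by apply: eq_bigr => p _; rewrite /= liftU.
move=> a x y; rewrite -[LHS]/(F _) raddfD; congr (_ + _).
rewrite -[fglift f x]/(F x) (FE x) scaler_sumr.
rewrite [a *: x](_ : _ = \sum_(p <- dom x) << a * coeff p x *g p >>) //.
by rewrite raddf_sum; apply: eq_bigr => p _; rewrite /= liftU scalerA.
Qed.

HB.instance Definition _ :=
  GRing.isLinear.Build rat {freeg T / rat} M _ (fglift f) fglift_linear.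

End FreeModule.

Section Tensor.
Variables V W : lmodType rat.

(* The defining relations of the tensor product, in the free module on V x W. *)
Definition tensor_rel : set {freeg (V * W)%type / rat} :=
  [set z | (exists a v v' w,
             z = << (a *: v + v', w) >> - (a *: << (v, w) >> + << (v', w) >>)) \/
           (exists a v w w',
             z = << (v, a *: w + w') >> - (a *: << (v, w) >> + << (v, w') >>))].

Definition tensor : Type := quotmod tensor_rel.

HB.instance Definition _ := GRing.Lmodule.on tensor.

Definition tens (v : V) (w : W) : tensor := \pi_(quotmod tensor_rel) << (v, w) >>.

Lemma tens_linearl w : linear (tens^~ w).
Proof.
move=> a v v'; rewrite /tens -quotmod_pi_linear; apply/quotmod_eqP/sub_span.
by left; exists a, v, v', w.
Qed.

Lemma tens_linearr v : linear (tens v).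
Proof.
move=> a w w'; rewrite /tens -quotmod_pi_linear; apply/quotmod_eqP/sub_span.
by right; exists a, v, w, w'.
Qed.

Section Lift.
Variables (M : lmodType rat) (b : V -> W -> M).
Hypothesis bl : forall w, linear (b^~ w).
Hypothesis br : forall v, linear (b v).

Let F : {linear {freeg (V * W)%type / rat} -> M} := fglift (fun p => b p.1 p.2).

Lemma tensor_lift0 z : span tensor_rel z -> F z = 0.
Proof.
elim=> [|a g x Gg _ Fx]; first exact: raddf0.
rewrite linearP Fx addr0; suff -> : F g = 0 by rewrite scaler0.
by case: Gg => [[c [v [v' [w ->]]]]|[c [v [w [w' ->]]]]];
  rewrite linearB linearP /= !liftU !scale1r /= ?bl ?br subrr.
Qed.

Definition tensor_lift (t : tensor) : M := F (repr (t : quotmod tensor_rel)).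

Lemma tensor_lift_pi z : tensor_lift (\pi_(quotmod tensor_rel) z) = F z.
Proof.
apply/eqP; rewrite -subr_eq0 -linearB; apply/eqP/tensor_lift0.
exact: quotmod_repr.
Qed.

Lemma tensor_liftE v w : tensor_lift (tens v w) = b v w.
Proof. by rewrite /tens tensor_lift_pi /= liftU scale1r. Qed.

Lemma tensor_lift_linear : linear tensor_lift.
Proof.
move=> a x y; rewrite -[x]quotmod_piP -[y]quotmod_piP -quotmod_pi_linear.
by rewrite !tensor_lift_pi linearP.
Qed.

End Lift.

Lemma tensor_span (t : tensor) : span [set tens p.1 p.2 | p in setT] t.
Proof.
rewrite -[t]quotmod_piP; move: (repr _) => z {t}.
rewrite -[z]freeg_sumE; elim: (dom z) => [|p s IH].
  by rewrite big_nil; apply: span0.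
rewrite big_cons; set u := \sum_(_ <- _) _ in IH *.
have -> : << coeff p z *g p >> = coeff p z *: << p >>.
  by apply/eqP/freeg_eqP => x; rewrite coeffZ !coeffU mul1r.
rewrite quotmod_pi_linear; apply: span_step => //.
by exists p => //; rewrite /tens -surjective_pairing.
Qed.

End Tensor.

Lemma tensor_ext (V W M : lmodType rat) (f g : {linear tensor V W -> M}) :
  (forall v w, f (tens v w) = g (tens v w)) -> f =1 g.
Proof.
move=> fg t; elim: (tensor_span t) => [|a _ x [p _ <-] _ IH].
  by rewrite !raddf0.
by rewrite !linearP fg IH.
Qed.

Section TensorMap.
Variables (V W V' W' : lmodType rat).
Variables (f : {linear V -> V'}) (g : {linear W -> W'}).

Definition tmap : tensor V W -> tensor V' W' :=
  tensor_lift (fun v w => tens (f v) (g w)).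

Fact tmap_linl w : linear (fun v => tens (f v) (g w)).
Proof. by move=> a v v'; rewrite linearP tens_linearl. Qed.

Fact tmap_linr v : linear (fun w => tens (f v) (g w)).
Proof. by move=> a w w'; rewrite linearP tens_linearr. Qed.

Lemma tmapE v w : tmap (tens v w) = tens (f v) (g w).
Proof. exact: (tensor_liftE tmap_linl tmap_linr). Qed.

Fact tmap_linear : linear tmap.
Proof. exact: (tensor_lift_linear tmap_linl tmap_linr). Qed.

HB.instance Definition _ :=
  GRing.isLinear.Build rat (tensor V W) (tensor V' W') _ tmap tmap_linear.

End TensorMap.

Lemma eq_tmap (V W V' W' : lmodType rat)
    (f f' : {linear V -> V'}) (g g' : {linear W -> W'}) :
  f =1 f' -> g =1 g' -> tmap f g =1 tmap f' g'.
Proof. by move=> ff gg; apply: tensor_ext => v w; rewrite /= !tmapE ff gg. Qed.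

Lemma tmap_comp (V1 W1 V2 W2 V3 W3 : lmodType rat)
    (f : {linear V1 -> V2}) (g : {linear W1 -> W2})
    (f' : {linear V2 -> V3}) (g' : {linear W2 -> W3}) t :
  tmap f' g' (tmap f g t) = tmap (f' \o f) (g' \o g) t.
Proof.
rewrite -[LHS]/((tmap f' g' \o tmap f g) t); apply: tensor_ext => v w.
by rewrite /= !tmapE.
Qed.

Lemma tmap_id (V W : lmodType rat) (t : tensor V W) : tmap idfun idfun t = t.
Proof.
rewrite -[RHS]/(idfun t); apply: tensor_ext => v w.
by rewrite /= tmapE.
Qed.

Lemma tens0r (V W : lmodType rat) (v : V) : tens v (0 : W) = 0.
Proof.
by have := @tens_linearr V W v (-1) 0 0; rewrite /= !scaleN1r oppr0 addr0 addNr.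
Qed.

Lemma tens0l (V W : lmodType rat) (w : W) : tens (0 : V) w = 0.
Proof.
by have := @tens_linearl V W w (-1) 0 0; rewrite /= !scaleN1r oppr0 addr0 addNr.
Qed.

Lemma tensDr (V W : lmodType rat) (v : V) (w w' : W) :
  tens v (w + w') = tens v w + tens v w'.
Proof. by have := @tens_linearr V W v 1 w w'; rewrite /= !scale1r. Qed.

Lemma tensDl (V W : lmodType rat) (v v' : V) (w : W) :
  tens (v + v') w = tens v w + tens v' w.
Proof. by have := @tens_linearl V W w 1 v v'; rewrite /= !scale1r. Qed.

Section Wedge.
Variable V : lmodType rat.

Definition wedge (x y : V) : tensor V V := tens x y - tens y x.

Definition alt2 : set (tensor V V) := span [set t | exists x y, t = wedge x y].

Lemma wedge_alt2 x y : alt2 (wedge x y).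
Proof. by apply: sub_span; exists x, y. Qed.

Lemma wedgeC x y : wedge y x = - wedge x y.
Proof. by rewrite /wedge opprB. Qed.

Lemma wedge0 x : wedge x 0 = 0.
Proof. by rewrite /wedge tens0r tens0l subrr. Qed.

Lemma wedgeDl x x' y : wedge (x + x') y = wedge x y + wedge x' y.
Proof. by rewrite /wedge tensDr tensDl opprD addrACA. Qed.

Lemma wedgeDr x y y' : wedge x (y + y') = wedge x y + wedge x y'.
Proof. by rewrite /wedge tensDr tensDl opprD addrACA. Qed.

End Wedge.

Lemma tmap_wedge (V W : lmodType rat) (f : {linear V -> W}) x y :
  tmap f f (wedge x y) = wedge (f x) (f y).
Proof. by rewrite linearB /= !tmapE. Qed.

Lemma span_tmap (V W : lmodType rat) (f : {linear V -> W})
    (G : set (tensor V V)) (S : set (tensor W W)) :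
  submodule S -> (forall t, G t -> S (tmap f f t)) ->
  forall t, span G t -> S (tmap f f t).
Proof.
move=> [S0 SD] GS t; elim=> [|a g x Gg _ IH]; first by rewrite raddf0.
by rewrite linearP; apply: SD => //; apply: GS.
Qed.

Section DirectSum.
Variables V W : lmodType rat.

Definition inj1 (v : V) : (V * W)%type := (v, 0).
Definition inj2 (w : W) : (V * W)%type := (0, w).

Fact inj1_linear : linear inj1.
Proof. by move=> a x y; rewrite /inj1; congr (_, _); rewrite /= scaler0 addr0. Qed.
Fact inj2_linear : linear inj2.
Proof. by move=> a x y; rewrite /inj2; congr (_, _); rewrite /= scaler0 addr0. Qed.

HB.instance Definition _ :=
  GRing.isLinear.Build rat V (V * W)%type _ inj1 inj1_linear.
HB.instance Definition _ :=
  GRing.isLinear.Build rat W (V * W)%type _ inj2 inj2_linear.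

(* [V, W]_- inside the tensor square of the direct sum. *)
Definition mixed_wedge : set (tensor (V * W)%type (V * W)%type) :=
  span [set t | exists v w, t = wedge (inj1 v) (inj2 w)].

End DirectSum.

Arguments inj1 {V} W v.
Arguments inj2 V {W} w.

(* Composition is written in application order: comp g f is "g after f". *)
Record category := Category {
  ob :> Type;
  hom : ob -> ob -> Type;
  idm : forall X, hom X X;
  comp : forall X Y Z, hom Y Z -> hom X Y -> hom X Z;
  comp_idl : forall X Y (f : hom X Y), comp (idm Y) f = f;
  comp_idr : forall X Y (f : hom X Y), comp f (idm X) = f;
  compA : forall X Y Z T (h : hom Z T) (g : hom Y Z) (f : hom X Y),
    comp h (comp g f) = comp (comp h g) f
}.

Arguments idm {c} X.
Notation "g \c f" := (comp g f) (at level 50, left associativity).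

Record sym_mon_category := SymMonCategory {
  smc_cat :> category;
  munit : smc_cat;
  mob : smc_cat -> smc_cat -> smc_cat;
  mhom : forall X Y X' Y', hom X X' -> hom Y Y' -> hom (mob X Y) (mob X' Y');
  assoc : forall X Y Z, hom (mob (mob X Y) Z) (mob X (mob Y Z));
  assoc_inv : forall X Y Z, hom (mob X (mob Y Z)) (mob (mob X Y) Z);
  lunit : forall X, hom (mob munit X) X;
  lunit_inv : forall X, hom X (mob munit X);
  runit : forall X, hom (mob X munit) X;
  runit_inv : forall X, hom X (mob X munit);
  braid : forall X Y, hom (mob X Y) (mob Y X);
  mhom_id : forall X Y, mhom (idm X) (idm Y) = idm (mob X Y);
  mhom_comp : forall X Y X' Y' X'' Y'' (f : hom X X') (g : hom Y Y')
    (f' : hom X' X'') (g' : hom Y' Y''),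
    mhom (f' \c f) (g' \c g) = mhom f' g' \c mhom f g;
  assocK : forall X Y Z, assoc_inv X Y Z \c assoc X Y Z = idm _;
  assocVK : forall X Y Z, assoc X Y Z \c assoc_inv X Y Z = idm _;
  lunitK : forall X, lunit_inv X \c lunit X = idm _;
  lunitVK : forall X, lunit X \c lunit_inv X = idm _;
  runitK : forall X, runit_inv X \c runit X = idm _;
  runitVK : forall X, runit X \c runit_inv X = idm _;
  assoc_nat : forall X Y Z X' Y' Z' (f : hom X X') (g : hom Y Y') (h : hom Z Z'),
    assoc X' Y' Z' \c mhom (mhom f g) h = mhom f (mhom g h) \c assoc X Y Z;
  lunit_nat : forall X Y (f : hom X Y),
    lunit Y \c mhom (idm munit) f = f \c lunit X;
  runit_nat : forall X Y (f : hom X Y),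
    runit Y \c mhom f (idm munit) = f \c runit X;
  braid_nat : forall X Y X' Y' (f : hom X X') (g : hom Y Y'),
    braid X' Y' \c mhom f g = mhom g f \c braid X Y;
  braidK : forall X Y, braid Y X \c braid X Y = idm _;
  triangle : forall X Y,
    mhom (idm X) (lunit Y) \c assoc X munit Y = mhom (runit X) (idm Y);
  pentagon : forall X Y Z T,
    assoc X Y (mob Z T) \c assoc (mob X Y) Z T
    = mhom (idm X) (assoc Y Z T) \c assoc X (mob Y Z) T
        \c mhom (assoc X Y Z) (idm T);
  hexagon : forall X Y Z,
    assoc Y Z X \c braid X (mob Y Z) \c assoc X Y Z
    = mhom (idm Y) (braid X Z) \c assoc Y X Z \c mhom (braid X Y) (idm Z)
}.

Arguments munit {s}.
Arguments mob {s} X Y.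
Arguments mhom {s X Y X' Y'} f g.
Arguments assoc {s} X Y Z.
Arguments assoc_inv {s} X Y Z.
Arguments lunit {s} X.
Arguments runit {s} X.
Arguments braid {s} X Y.

(* The labels 1, ..., n are represented by the elements 0, ..., n - 1 of 'I_n. *)
Section Insertion.
Variables n m : nat.
Implicit Types (p : 'I_n) (s : 'S_n) (t : 'S_m).

(* collapse p is the map pi_p, and inner p shifts a label of the inserted block
   into place (J |-> J + p - 1 on labels counted from 1). *)
Fact collapse_subproof p (x : 'I_(n + m).-1) :
  ((if x < p then x : nat else if x < p + m then p : nat else x.+1 - m) < n)%N.
Proof.
by have := ltn_ord x; have := ltn_ord p; case: ifP => ?; last case: ifP => ?; lia.
Qed.

Definition collapse p (x : 'I_(n + m).-1) : 'I_n := Ordinal (collapse_subproof p x).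

Fact inner_subproof p (j : 'I_m) : (p + j < (n + m).-1)%N.
Proof. by have := ltn_ord j; have := ltn_ord p; lia. Qed.

Definition inner p (j : 'I_m) : 'I_(n + m).-1 := Ordinal (inner_subproof p j).

(* The position after inserting m inputs at p of an input at i <> p. *)
Definition outer_pos p (i : 'I_n) : nat := if (i < p)%N then i : nat else (i + m).-1.

Definition block_fun p (s : 'S_n) (t : 'S_m) (x : 'I_(n + m).-1) : 'I_(n + m).-1 :=
  if (if (p <= x)%N then insub (x - p)%N : option 'I_m else None) is Some j
  then inner (s p) (t j)
  else insubd x (outer_pos (s p) (s (collapse p x))).

Lemma block_fun_inner p s t (j : 'I_m) :
  block_fun p s t (inner p j) = inner (s p) (t j).
Proof. by rewrite /block_fun /= leq_addr addKn valK. Qed.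

Lemma collapseP p (x : 'I_(n + m).-1) :
  (exists j, x = inner p j) \/
  [/\ collapse p x <> p, outer_pos p (collapse p x) = x
    & (if (p <= x)%N then insub (x - p)%N : option 'I_m else None) = None].
Proof.
case: (boolP (p <= x < p + m)%N) => [/andP[px xpm]|px].
  have jm : (x - p < m)%N by lia.
  by left; exists (Ordinal jm); apply: val_inj; rewrite /= subnKC.
right; split.
- move=> /(congr1 val) /=.
  by case: (ltnP x p) => ? ; last case: (ltnP x (p + m)) => ?; lia.
- rewrite /outer_pos /=; case: (ltnP x p) => xp; first by rewrite xp.
  have [xpm pxm] : (x < p + m)%N = false /\ (x.+1 - m < p)%N = false by lia.
  by rewrite xpm pxm; have := ltn_ord x; lia.
- by case: leqP => // pxle; rewrite insubN //; lia.
Qed.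

Lemma outer_pos_lt p i : i <> p -> (outer_pos p i < (n + m).-1)%N.
Proof.
move=> ip; have {ip}: (i : nat) <> p by move=> /val_inj.
by rewrite /outer_pos; have := ltn_ord i; have := ltn_ord p; case: ifP => ?; lia.
Qed.

Lemma collapse_outer p i (x : 'I_(n + m).-1) :
  i <> p -> x = outer_pos p i :> nat -> collapse p x = i.
Proof.
move=> ip xE; have {}ip: (i : nat) <> p by move=> /val_inj.
apply: val_inj => /=; move: xE; rewrite /outer_pos.
have := ltn_ord i; have := ltn_ord p.
by case: ifP => ? ? ? ->; case: ifP => ?; try (case: ifP => ?); lia.
Qed.

Lemma collapse_inner p (j : 'I_m) : collapse p (inner p j) = p.
Proof.
apply: val_inj => /=; have := ltn_ord j.
by case: ifP => ?; last case: ifP => ?; lia.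
Qed.

Lemma collapse_block_fun p s t x :
  collapse (s p) (block_fun p s t x) = s (collapse p x).
Proof.
have [[j ->]|[xp _ E]] := collapseP p x.
  by rewrite block_fun_inner !collapse_inner.
rewrite /block_fun E; have sp : s (collapse p x) <> s p by move/perm_inj.
by apply: collapse_outer => //; rewrite val_insubd outer_pos_lt.
Qed.

Lemma block_fun_inj p s t : injective (block_fun p s t).
Proof.
move=> x y xy; have := collapse_block_fun p s t x.
rewrite xy collapse_block_fun => /perm_inj cxy.
have [[j xE]|[xp Ex _]] := collapseP p x; have [[j' yE]|[yp Ey _]] := collapseP p y.
- move: xy; rewrite xE yE !block_fun_inner => /(congr1 val) /= /addnI.
  by move=> /val_inj /perm_inj ->.
- by case: yp; rewrite cxy xE collapse_inner.
- by case: xp; rewrite -cxy yE collapse_inner.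
- by apply: val_inj; rewrite /= -Ex -Ey cxy.
Qed.

(* The block permutation s o_p t: it carries the inserted block p + J to the
   block s(p) + t(J), and permutes the remaining positions as s does. *)
Definition block_perm p (s : 'S_n) (t : 'S_m) : 'S_(n + m).-1 :=
  perm (@block_fun_inj p s t).

Lemma block_perm_inner p s t j : block_perm p s t (inner p j) = inner (s p) (t j).
Proof. by rewrite permE block_fun_inner. Qed.

Lemma collapse_block_perm p s t x :
  collapse (s p) (block_perm p s t x) = s (collapse p x).
Proof. by rewrite permE collapse_block_fun. Qed.

End Insertion.

Fact par_pos_gt_subproof n m (i k : 'I_n) : (i < k)%N -> ((k + m).-1 < (n + m).-1)%N.
Proof. by have := ltn_ord k; lia. Qed.

Fact par_pos_lt_subproof n m (i k : 'I_n) : (i < k)%N -> (i < (n + m).-1)%N.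
Proof. by have := ltn_ord k; lia. Qed.

(* For i < k, the positions of k after an insertion of m inputs at i, and of i
   after an insertion of m inputs at k. *)
Definition par_pos_gt n m (i k : 'I_n) (ik : (i < k)%N) : 'I_(n + m).-1 :=
  Ordinal (par_pos_gt_subproof m ik).
Definition par_pos_lt n m (i k : 'I_n) (ik : (i < k)%N) : 'I_(n + m).-1 :=
  Ordinal (par_pos_lt_subproof m ik).

Fact seq_arity l m n (i : 'I_l) (j : 'I_m) :
  ((l + m).-1 + n).-1 = (l + (m + n).-1).-1.
Proof. by have := ltn_ord i; have := ltn_ord j; lia. Qed.

Fact par_arity l m n (i k : 'I_l) (ik : (i < k)%N) :
  ((l + n).-1 + m).-1 = ((l + m).-1 + n).-1.
Proof. by have := ltn_ord k; lia. Qed.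

Fact unit_arity n : (n + 1).-1 = n.
Proof. by rewrite addn1. Qed.

Definition arity_cast (C : category) (P : nat -> C) n n' (e : n = n') :
    hom (P n) (P n') :=
  match e in _ = k return hom (P n) (P k) with erefl => idm (P n) end.

Arguments arity_cast {C} P {n n'} e.

(* An operad structure on the components P. The symmetric group acts on the
   left by relabelling of inputs (the action of s is the usual right action of
   its inverse); since (s * t)%g is "s then t", this makes op_perm (s * t) the
   composite of op_perm t after op_perm s. *)
Record operad_on (C : sym_mon_category) (P : nat -> C) := OperadOn {
  op_perm : forall n, 'S_n -> hom (P n) (P n);
  op_circ : forall n m, 'I_n -> hom (mob (P n) (P m)) (P (n + m).-1);
  op_unit : hom munit (P 1%N);
  op_perm1 : forall n, op_perm (1%g : 'S_n) = idm (P n);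
  op_permM : forall n (s t : 'S_n), op_perm (s * t)%g = op_perm t \c op_perm s;
  op_equivariant : forall n m (p : 'I_n) (s : 'S_n) (t : 'S_m),
    op_circ m (s p) \c mhom (op_perm s) (op_perm t)
    = op_perm (block_perm p s t) \c op_circ m p;
  op_seq : forall l m n (i : 'I_l) (j : 'I_m),
    arity_cast P (seq_arity n i j) \c op_circ n (inner i j)
      \c mhom (op_circ m i) (idm (P n))
    = op_circ (m + n).-1 i \c mhom (idm (P l)) (op_circ n j)
      \c assoc (P l) (P m) (P n);
  op_par : forall l m n (i k : 'I_l) (ik : (i < k)%N),
    op_circ n (par_pos_gt m ik) \c mhom (op_circ m i) (idm (P n))
    = arity_cast P (par_arity m n ik) \c op_circ m (par_pos_lt n ik)
      \c mhom (op_circ n k) (idm (P m))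
      \c assoc_inv (P l) (P n) (P m) \c mhom (idm (P l)) (braid (P m) (P n))
      \c assoc (P l) (P m) (P n);
  op_unitl : forall n,
    op_circ n (ord0 : 'I_1) \c mhom op_unit (idm (P n)) = lunit (P n);
  op_unitr : forall n (p : 'I_n),
    arity_cast P (unit_arity n) \c op_circ 1 p \c mhom (idm (P n)) op_unit
    = runit (P n)
}.

Arguments op_perm {C P} o {n} s.
Arguments op_circ {C P} o {n} m p.
Arguments op_unit {C P} o.

Record QD := MkQD {
  qd_space :> lmodType rat;
  qd_rel : set (tensor qd_space qd_space);
  qd_rel_submodule : submodule qd_rel;
  qd_rel_alt2 : qd_rel `<=` @alt2 qd_space
}.

Record QDhom (X Y : QD) := MkQDhom {
  qd_map :> {linear X -> Y};
  qd_mapP : forall r, qd_rel r -> qd_rel (tmap qd_map qd_map r)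
}.

Lemma eq_linear (V W : lmodType rat) (f g : {linear V -> W}) : f =1 g -> f = g.
Proof.
case: f g => [f [[f0] [f1]]] [g [[g0] [g1]]] /= /funext fg; subst g.
by rewrite (Prop_irrelevance f0 g0) (Prop_irrelevance f1 g1).
Qed.

Lemma QDhom_ext (X Y : QD) (f g : QDhom X Y) : f =1 g -> f = g.
Proof.
case: f g => [f fP] [g gP] /= /eq_linear fg; subst g.
by rewrite (Prop_irrelevance fP gP).
Qed.

Fact QDid_subproof (X : QD) r :
  qd_rel r -> qd_rel (tmap (@idfun X) (@idfun X) r).
Proof. by rewrite tmap_id. Qed.

Definition QDid (X : QD) : QDhom X X := MkQDhom (@QDid_subproof X).

Fact QDcomp_subproof (X Y Z : QD) (g : QDhom Y Z) (f : QDhom X Y) r :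
  qd_rel r -> qd_rel (tmap (g \o f) (g \o f) r).
Proof. by move=> Rr; rewrite -tmap_comp; apply/qd_mapP/qd_mapP. Qed.

Definition QDcomp (X Y Z : QD) (g : QDhom Y Z) (f : QDhom X Y) : QDhom X Z :=
  MkQDhom (QDcomp_subproof g f).

Definition QDcat : category.
Proof.
by refine (@Category QD QDhom QDid QDcomp _ _ _) => *; apply: QDhom_ext.
Defined.

Section QDsum.
Variables X Y : QD.

Definition QDsum_rel : set (tensor (X * Y)%type (X * Y)%type) :=
  [set t | exists r c s, [/\ qd_rel r, mixed_wedge c, qd_rel s
    & t = tmap (inj1 Y) (inj1 Y) r + c + tmap (inj2 X) (inj2 X) s]].

Fact QDsum_submodule : submodule QDsum_rel.
Proof.
split=> [|a _ _ [r [c [s [Rr Cc Ss ->]]]] [r' [c' [s' [Rr' Cc' Ss' ->]]]]].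
  exists 0, 0, 0; rewrite !raddf0 !addr0; split=> //.
  - by case: (qd_rel_submodule X).
  - exact: span0.
  - by case: (qd_rel_submodule Y).
exists (a *: r + r'), (a *: c + c'), (a *: s + s'); split.
- by case: (qd_rel_submodule X) => _; apply.
- by case: (span_submodule [set t | exists v w, t = wedge (inj1 Y v) (inj2 X w)]) => _; apply.
- by case: (qd_rel_submodule Y) => _; apply.
- by rewrite !linearP /= !scalerDr (addrACA (_ + _)) (addrACA (a *: _)).
Qed.

Fact QDsum_alt2 : QDsum_rel `<=` @alt2 (X * Y)%type.
Proof.
have aP (V W : lmodType rat) (f : {linear V -> W}) r : alt2 r -> alt2 (tmap f f r).
  apply: span_tmap; first exact: span_submodule.
  by move=> _ [x [y ->]]; rewrite tmap_wedge; apply: wedge_alt2.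
move=> _ [r [c [s [Rr Cc Ss ->]]]]; apply: spanD; first apply: spanD.
- by apply/aP/qd_rel_alt2.
- apply: span_min Cc; first exact: span_submodule.
  by move=> _ [v [w ->]]; apply: wedge_alt2.
- by apply/aP/qd_rel_alt2.
Qed.

Definition QDsum : QD :=
  @MkQD (X * Y)%type QDsum_rel QDsum_submodule QDsum_alt2.

Lemma QDsum_inj1 r : qd_rel r -> @qd_rel QDsum (tmap (inj1 Y) (inj1 Y) r).
Proof.
move=> Rr; exists r, 0, 0; rewrite raddf0 !addr0; split=> //; first exact: span0.
by case: (qd_rel_submodule Y).
Qed.

Lemma QDsum_inj2 r : qd_rel r -> @qd_rel QDsum (tmap (inj2 X) (inj2 X) r).
Proof.
move=> Rr; exists 0, 0, r; rewrite raddf0 !add0r; split=> //; last exact: span0.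
by case: (qd_rel_submodule X).
Qed.

Lemma QDsum_mixed x y : @qd_rel QDsum (wedge (inj1 Y x) (inj2 X y)).
Proof.
exists 0, (wedge (inj1 Y x) (inj2 X y)), 0; rewrite !raddf0 add0r addr0.
split=> //; [by case: (qd_rel_submodule X)| |by case: (qd_rel_submodule Y)].
by apply: sub_span; exists x, y.
Qed.

End QDsum.

Lemma qd_relN (X : QD) r : @qd_rel X r -> qd_rel (- r).
Proof.
move=> Rr; rewrite -scaleN1r -[X in qd_rel X]addr0.
by case: (qd_rel_submodule X) => R0 RD; apply: RD.
Qed.

Lemma qd_relC (X : QD) (x y : X) : qd_rel (wedge x y) -> qd_rel (wedge y x).
Proof. by rewrite (wedgeC x y); apply: qd_relN. Qed.

Lemma qd_rel_wedge0 (X : QD) (x : X) : qd_rel (wedge x 0).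
Proof.
by rewrite wedge0; case: (qd_rel_submodule X).
Qed.

Lemma QDhom_wedge (X Y : QD) (f : QDhom X Y) x y :
  qd_rel (wedge x y) -> qd_rel (wedge (f x) (f y)).
Proof. by move=> Rxy; rewrite -tmap_wedge; apply: qd_mapP. Qed.

Lemma QDsum_univ (X Y Z : QD) (h : {linear (X * Y)%type -> Z}) :
  (forall r, @qd_rel X r -> qd_rel (tmap (h \o inj1 Y) (h \o inj1 Y) r)) ->
  (forall s, @qd_rel Y s -> qd_rel (tmap (h \o inj2 X) (h \o inj2 X) s)) ->
  (forall x y, qd_rel (wedge (h (inj1 Y x)) (h (inj2 X y)))) ->
  forall t, @qd_rel (QDsum X Y) t -> qd_rel (tmap h h t).
Proof.
move=> h1 h2 h12 _ [r [c [s [Rr Cc Ss ->]]]].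
have ZD u v : @qd_rel Z u -> qd_rel v -> qd_rel (u + v).
  by move=> Ru Rv; rewrite -[u]scale1r; apply: (qd_rel_submodule Z).2.
rewrite !raddfD /= !tmap_comp; apply: (ZD); first apply: (ZD).
- exact: h1.
- apply: span_tmap Cc; first exact: qd_rel_submodule.
  by move=> _ [x [y ->]]; rewrite tmap_wedge; apply: h12.
- exact: h2.
Qed.

Definition qd0_space : lmodType rat := 'rV[rat]_0.

Lemma qd0_eq0 (x : qd0_space) : x = 0.
Proof. exact: thinmx0. Qed.

Lemma tensor_qd0 (t : tensor qd0_space qd0_space) : t = 0.
Proof.
rewrite -[LHS]/(idfun t) -[RHS]/((\0 : tensor _ _ -> _) t).
by apply: tensor_ext => v w /=; rewrite (qd0_eq0 w) tens0r.
Qed.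

Fact qd0_submodule : submodule [set (0 : tensor qd0_space qd0_space)].
Proof. by split=> // a x y _ _; apply: tensor_qd0. Qed.

Fact qd0_alt2 : [set (0 : tensor qd0_space qd0_space)] `<=` @alt2 qd0_space.
Proof. by move=> _ ->; apply: span0. Qed.

Definition QD0 : QD := MkQD qd0_submodule qd0_alt2.

Section QDstructure.
Variables X Y Z : QD.

Definition lassoc (u : (X * Y) * Z) : X * (Y * Z) := (u.1.1, (u.1.2, u.2)).
Definition lassoc_inv (u : X * (Y * Z)) : (X * Y) * Z := ((u.1, u.2.1), u.2.2).
Definition lbraid (u : X * Y) : Y * X := (u.2, u.1).

Fact lassoc_linear : linear lassoc. Proof. by []. Qed.
Fact lassoc_inv_linear : linear lassoc_inv. Proof. by []. Qed.
Fact lbraid_linear : linear lbraid. Proof. by []. Qed.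

HB.instance Definition _ := GRing.isLinear.Build rat
  ((X * Y) * Z)%type (X * (Y * Z))%type _ lassoc lassoc_linear.
HB.instance Definition _ := GRing.isLinear.Build rat
  (X * (Y * Z))%type ((X * Y) * Z)%type _ lassoc_inv lassoc_inv_linear.
HB.instance Definition _ := GRing.isLinear.Build rat
  (X * Y)%type (Y * X)%type _ lbraid lbraid_linear.

End QDstructure.

Section PairMap.
Variables (X Y X' Y' : QD) (f : QDhom X X') (g : QDhom Y Y').
Definition lpair (u : X * Y) : X' * Y' := (f u.1, g u.2).
Fact lpair_linear : linear lpair.
Proof. by move=> a x y; rewrite /lpair /= !linearP. Qed.
HB.instance Definition _ := GRing.isLinear.Build rat
  (X * Y)%type (X' * Y')%type _ lpair lpair_linear.

Fact QDpair_subproof r :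
  @qd_rel (QDsum X Y) r -> @qd_rel (QDsum X' Y') (tmap lpair lpair r).
Proof.
apply: QDsum_univ.
- move=> s Ss; rewrite (@eq_tmap _ _ _ _ _ (inj1 Y' \o f) _ (inj1 Y' \o f)).
  + by rewrite -tmap_comp; apply/QDsum_inj1/qd_mapP.
  + by move=> x; rewrite /= /lpair /= raddf0.
  + by move=> x; rewrite /= /lpair /= raddf0.
- move=> s Ss; rewrite (@eq_tmap _ _ _ _ _ (inj2 X' \o g) _ (inj2 X' \o g)).
  + by rewrite -tmap_comp; apply/QDsum_inj2/qd_mapP.
  + by move=> x; rewrite /= /lpair /= raddf0.
  + by move=> x; rewrite /= /lpair /= raddf0.
- by move=> x y; rewrite /= /lpair /= !raddf0; apply: QDsum_mixed.
Qed.

Definition QDpair : QDhom (QDsum X Y) (QDsum X' Y') := MkQDhom QDpair_subproof.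
End PairMap.

Definition QDinj1 (X Y : QD) : QDhom X (QDsum X Y) := MkQDhom (@QDsum_inj1 X Y).
Definition QDinj2 (X Y : QD) : QDhom Y (QDsum X Y) := MkQDhom (@QDsum_inj2 X Y).

(* A linear map that agrees with a morphism on each summand is a morphism as
   soon as it maps mixed wedges to relations. *)
Lemma QDsum_homP (X Y Z : QD) (h : {linear (X * Y)%type -> Z})
    (f : QDhom X Z) (g : QDhom Y Z) :
  (forall x, h (inj1 Y x) = f x) -> (forall y, h (inj2 X y) = g y) ->
  (forall x y, qd_rel (wedge (f x) (g y))) ->
  forall t, @qd_rel (QDsum X Y) t -> qd_rel (tmap h h t).
Proof.
move=> hf hg fg; apply: QDsum_univ => [r Rr|s Ss|x y].
- by rewrite (@eq_tmap _ _ _ _ _ f _ f) //; apply: qd_mapP.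
- by rewrite (@eq_tmap _ _ _ _ _ g _ g) //; apply: qd_mapP.
- by rewrite hf hg.
Qed.

Section QDmonoidal.
Variables X Y Z : QD.

Fact QDbraid_subproof r :
  @qd_rel (QDsum X Y) r -> @qd_rel (QDsum Y X) (tmap (@lbraid X Y) (@lbraid X Y) r).
Proof.
apply: (QDsum_homP (f := QDinj2 Y X) (g := QDinj1 Y X)) => // x y.
exact/qd_relC/QDsum_mixed.
Qed.
Definition QDbraid : QDhom (QDsum X Y) (QDsum Y X) := MkQDhom QDbraid_subproof.

Fact QDlunit_subproof r :
  @qd_rel (QDsum QD0 X) r -> qd_rel (tmap (@snd QD0 X) (@snd QD0 X) r).
Proof.
have z0 s : @qd_rel QD0 s -> @qd_rel X (tmap \0 \0 s).
  by move=> _; rewrite (tensor_qd0 s) raddf0; case: (qd_rel_submodule X).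
apply: (QDsum_homP (f := MkQDhom z0) (g := QDid X)) => // x y.
exact/qd_relC/qd_rel_wedge0.
Qed.
Definition QDlunit : QDhom (QDsum QD0 X) X := MkQDhom QDlunit_subproof.

Fact QDrunit_subproof r :
  @qd_rel (QDsum X QD0) r -> qd_rel (tmap (@fst X QD0) (@fst X QD0) r).
Proof.
have z0 s : @qd_rel QD0 s -> @qd_rel X (tmap \0 \0 s).
  by move=> _; rewrite (tensor_qd0 s) raddf0; case: (qd_rel_submodule X).
by apply: (QDsum_homP (f := QDid X) (g := MkQDhom z0)) => // x y; apply: qd_rel_wedge0.
Qed.
Definition QDrunit : QDhom (QDsum X QD0) X := MkQDhom QDrunit_subproof.

Let mixedE (A B : QD) (a : A) (b : B) (C : QD) (h : QDhom (QDsum A B) C) :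
  qd_rel (wedge (h (inj1 B a)) (h (inj2 A b))).
Proof. exact/QDhom_wedge/QDsum_mixed. Qed.

Fact QDassoc_subproof r :
  @qd_rel (QDsum (QDsum X Y) Z) r ->
  @qd_rel (QDsum X (QDsum Y Z)) (tmap (@lassoc X Y Z) (@lassoc X Y Z) r).
Proof.
apply: (QDsum_homP (f := QDpair (QDid X) (QDinj1 Y Z))
                   (g := QDcomp (QDinj2 X (QDsum Y Z)) (QDinj2 Y Z))) => //.
move=> [x y] z; have -> : QDpair (QDid X) (QDinj1 Y Z) (x, y)
  = inj1 _ x + QDinj2 X (QDsum Y Z) (QDinj1 Y Z y).
  by rewrite /= /lpair /= /inj1 /inj2; congr (_, _); rewrite /= ?addr0 ?add0r.
set w := QDcomp _ _ _.
rewrite wedgeDl -[X in qd_rel (X + _)]scale1r.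
apply: (qd_rel_submodule (QDsum X (QDsum Y Z))).2.
  exact: (@QDsum_mixed X (QDsum Y Z) x (inj2 Y z)).
by apply: (@QDhom_wedge _ _ (QDinj2 X (QDsum Y Z))); apply: QDsum_mixed.
Qed.
Definition QDassoc : QDhom (QDsum (QDsum X Y) Z) (QDsum X (QDsum Y Z)) :=
  MkQDhom QDassoc_subproof.

Fact QDassoc_inv_subproof r :
  @qd_rel (QDsum X (QDsum Y Z)) r ->
  @qd_rel (QDsum (QDsum X Y) Z) (tmap (@lassoc_inv X Y Z) (@lassoc_inv X Y Z) r).
Proof.
apply: (QDsum_homP (f := QDcomp (QDinj1 (QDsum X Y) Z) (QDinj1 X Y))
                   (g := QDpair (QDinj2 X Y) (QDid Z))) => //.
move=> x [y z]; have -> : QDpair (QDinj2 X Y) (QDid Z) (y, z)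
  = inj2 _ z + QDinj1 (QDsum X Y) Z (QDinj2 X Y y).
  by rewrite /= /lpair /= /inj1 /inj2; congr (_, _); rewrite /= ?addr0 ?add0r.
set w := QDcomp _ _ _.
rewrite wedgeDr -[X in qd_rel (X + _)]scale1r.
apply: (qd_rel_submodule (QDsum (QDsum X Y) Z)).2.
  exact: (@QDsum_mixed (QDsum X Y) Z (inj1 Y x) z).
by apply: (@QDhom_wedge _ _ (QDinj1 (QDsum X Y) Z)); apply: QDsum_mixed.
Qed.
Definition QDassoc_inv : QDhom (QDsum X (QDsum Y Z)) (QDsum (QDsum X Y) Z) :=
  MkQDhom QDassoc_inv_subproof.

End QDmonoidal.

Definition QDm : sym_mon_category.
Proof.
refine (@SymMonCategory QDcat QD0 QDsum QDpair QDassoc QDassoc_inv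
  QDlunit (QDinj2 QD0) QDrunit (QDinj1 ^~ QD0) QDbraid
  _ _ _ _ _ _ _ _ _ _ _ _ _ _ _ _) => *; apply: QDhom_ext => u //=.
all: try by case: u.
all: try by rewrite /lpair /= !raddf0.
- by case: u => [[]].
- by case: u => ? [].
- by case: u => a x; rewrite [a]qd0_eq0.
- by case: u => x a; rewrite [a]qd0_eq0.
Defined.

Section Hypergraphs.
Variable k : nat.

Definition hyperedge (n : nat) : Type := {I : {set 'I_n} | #|I| == k}.
HB.instance Definition _ n := Finite.on (hyperedge n).

Definition HGspace (n : nat) : lmodType rat := {ffun hyperedge n -> rat^o}.

(* t^n_I; this is the basis vector at I when #|I| = k, and 0 otherwise. *)
Definition hg (n : nat) (I : {set 'I_n}) : HGspace n :=
  [ffun J : hyperedge n => (val J == I)%:R].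

Definition HGgen (n : nat) : set (tensor (HGspace n) (HGspace n)) :=
  [set r |
    (exists I J : {set 'I_n}, [/\ #|I| = k, #|J| = k, [disjoint I & J]%B
       & r = wedge (hg I) (hg J)]) \/
    (exists I J : {set 'I_n}, [/\ #|I| = k, #|J| = k.-1, [disjoint I & J]%B
       & r = wedge (hg I) (\sum_(i in I) hg (i |: J)%SET)])].

Definition HGrel (n : nat) := span (@HGgen n).

Fact HGrel_alt2 n : @HGrel n `<=` @alt2 (HGspace n).
Proof.
apply: span_min; first exact: span_submodule.
by move=> _ [[I [J [_ _ _ ->]]]|[I [J [_ _ _ ->]]]]; apply: wedge_alt2.
Qed.

Definition HG (n : nat) : QDm := MkQD (span_submodule (@HGgen n)) (@HGrel_alt2 n).

(* The linear map sending the basis vector at I to F I. *)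
Definition HGlin (n : nat) (M : lmodType rat) (F : {set 'I_n} -> M)
    (x : HGspace n) : M :=
  \sum_(I : hyperedge n) x I *: F (val I).

Definition HGperm (n : nat) (s : 'S_n) : HGspace n -> HGspace n :=
  HGlin (fun I => hg [set s i | i in I]%SET).

Definition HGcirc (n m : nat) (p : 'I_n) (u : HGspace n * HGspace m) :
    HGspace (n + m).-1 :=
  HGlin (fun I => \sum_(I' : {set 'I_(n + m).-1}
                        | [&& #|I'| == k, dinjectiveb (collapse p) (mem I')
                            & [set collapse p x | x in I']%SET == I]) hg I') u.1
  + HGlin (fun J => hg [set inner p j | j in J]%SET) u.2.

Lemma HGlin_hg n (M : lmodType rat) (F : {set 'I_n} -> M) (I : {set 'I_n}) :
  #|I| = k -> HGlin F (hg I) = F I.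
Proof.
move=> /eqP Ik; rewrite /HGlin (bigD1 (Sub I Ik : hyperedge n)) //=.
rewrite ffunE eqxx scale1r big1 ?addr0 // => J JI; rewrite ffunE.
by case: eqP => [E|_]; [case/eqP: JI; apply: val_inj | rewrite scale0r].
Qed.

End Hypergraphs.

(* Main.v *)
Require Import Defs.
From HB Require Import structures.
From mathcomp Require Import all_boot fingroup perm all_algebra.
From mathcomp Require Import zify.

Set Implicit Arguments.
Unset Strict Implicit.
Unset Printing Implicit Defensive.

Import GRing.Theory.
Local Open Scope ring_scope.

(** All the structure maps are instances of one construction.  A partial map
    [f : 'I_N -> option 'I_n] pulls hypergraphs back: [pull f] sends [t_I] to
    the sum of the [t_K] over the sets [K] in the domain of [f] which [f] maps
    bijectively onto [I].  If [t_I] is thought of as a squarefree monomial, this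
    is the substitution of the sum of the [x_a], over [a] in the fibre of [b],
    for each variable [x_b].  The action of [s] is the pullback along the
    inverse of [s]; on its first summand [o_p] is the pullback along [pi_p], and
    on its second summand the pullback along the partial inverse [uninner p] of
    the inclusion [inner p] of the inserted block.

    Two facts about pullbacks then give the theorem.

    They are contravariantly functorial ([pull_comp]), so that each operad axiom
    reduces to equations between partial maps of finite ordinals, one for each
    summand of the source.  Even the exchange of a restriction to an inserted
    block with a collapse is such an equation, which is why partial maps are used
    instead of collapses and inclusions separately.

    They preserve the defining relations ([pull_rel]).  Disjoint sets have
    disjoint lifts.  For a hyperedge [I] and a disjoint [J], fix lifts [K] of [I]
    and [L] of [J]: the terms that remain pair [t_K] with [t_{y, L}] for all [y]
    lying over [I].  Those with [y] in [K] add up to a defining relation, and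
    each of the others is a wedge of disjoint hyperedges ([HGrel_star]).  The
    mixed wedges that [o_p] must also send to relations yield to the same
    dichotomy, with the inserted block in place of the points over [I]
    ([circ_mixed]). *)

(** * Lifting sets along partial maps *)

Section Lifts.
Variables X Y : finType.
Implicit Types (f : X -> option Y) (I J : {set Y}) (K L : {set X}).

(** Injectivity of [f] on [K] is encoded by the cardinalities, and the inclusion
    of [K] in the domain of [f] by the absence of [None] from the image: with an
    equation of images, composition of partial maps becomes [imset_comp]. *)
Definition lifts f I K : bool := (#|K| == #|I|) && (f @: K == Some @: I).

Lemma lifts_card f I K : lifts f I K -> #|K| = #|I|.
Proof. by case/andP=> /eqP. Qed.

Lemma lifts_mem f I K x : lifts f I K -> x \in K -> exists2 i, i \in I & f x = Some i.
Proof.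
case/andP=> _ /eqP fK xK; have: f x \in Some @: I by rewrite -fK imset_f.
by case/imsetP=> i iI ->; exists i.
Qed.

Lemma lifts_inj f I K : lifts f I K -> {in K &, injective f}.
Proof.
case/andP=> /eqP cK /eqP fK; apply/imset_injP.
by rewrite fK cK card_imset //; apply: Some_inj.
Qed.

Lemma lifts_disjoint f I J K L :
  lifts f I K -> lifts f J L -> [disjoint I & J] -> [disjoint K & L].
Proof.
move=> fIK fJL IJ; apply/pred0P=> x /=; apply/negP=> /andP[xK xL].
have [i iI fi] := lifts_mem fIK xK; have [j jJ fj] := lifts_mem fJL xL.
move: jJ; have -> : j = i by apply: Some_inj; rewrite -fi -fj.
by rewrite (disjointFr IJ iI).
Qed.

Lemma lifts_setU1 f i J y L : i \notin J -> lifts f J L -> f y = Some i ->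
  lifts f (i |: J) (y |: L).
Proof.
move=> iJ fJL fy; have yL : y \notin L.
  apply/negP=> /(lifts_mem fJL)[j jJ]; rewrite fy => -[ij].
  by rewrite ij jJ in iJ.
case/andP: fJL => /eqP cL /eqP fL.
by rewrite /lifts !cardsU1 iJ yL cL eqxx !imsetU1 fy fL eqxx.
Qed.

(** A lift of [i |: J] is a lift of [J] together with a point of the fibre of
    [i]. *)
Lemma big_lifts_setU1 (M : nmodType) (F : {set X} -> M) f i J : i \notin J ->
  \sum_(K | lifts f (i |: J) K) F K
  = \sum_(L | lifts f J L) \sum_(y | f y == Some i) F (y |: L).
Proof.
move=> iJ; pose h K := [set x in K | f x != Some i].
have split K : lifts f (i |: J) K ->
    exists y, [/\ f y = Some i, K = y |: h K & lifts f J (h K)].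
  move=> fK; have [y yK fy] : exists2 y, y \in K & f y = Some i.
    have: Some i \in f @: K.
      by case/andP: fK => _ /eqP ->; rewrite imset_f ?setU11.
    by case/imsetP=> y yK ->; exists y.
  have KE : K = y |: h K.
    apply/setP=> x; rewrite !inE; case: (eqVneq x y) => [->|xy] //=.
    case: (boolP (x \in K)) => //= xK; apply/esym; apply: contraNN xy => /eqP fx.
    by apply/eqP/(lifts_inj fK); rewrite ?fy.
  (* What is left of K after removing its point over i is a lift of J. *)
  exists y; split=> //; case/andP: (fK) => cK /eqP fKE.
  have yh : y \notin h K by rewrite inE fy eqxx andbF.
  move: cK; rewrite {1}KE !cardsU1 yh iJ eqSS /lifts => -> /=.
  apply/eqP/setP=> o; apply/imsetP/imsetP=> [[x]|[j jJ ->]].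
    rewrite inE => /andP[xK fx ->]; have [j] := lifts_mem fK xK.
    by rewrite !inE => /orP[/eqP->|jJ] fxj; [rewrite fxj eqxx in fx | exists j].
  have: Some j \in f @: K by rewrite fKE imset_f // !inE jJ orbT.
  case/imsetP=> x xK xj; exists x => //; rewrite inE xK -xj.
  by apply: contraNneq iJ => -[<-].
rewrite (partition_big h (lifts f J)) => [|K /split[y []//]].
apply: eq_bigr => L fL.
have Lfib y : f y == Some i -> y \notin L.
  move=> /eqP fy; apply/negP=> /(lifts_mem fL)[j jJ]; rewrite fy => -[ij].
  by rewrite ij jJ in iJ.
rewrite -(big_imset F (h := fun y => y |: L) (A := [pred y | f y == Some i])) /=.
  apply: eq_bigl => K; apply/andP/imsetP => [[/split[y [fy KE _]] /eqP hK]|[y]].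
    by exists y; rewrite ?inE ?fy // KE hK.
  rewrite inE => fy ->; split; first by apply: lifts_setU1 => //; apply/eqP.
  apply/eqP/setP=> x; rewrite !inE; case: (eqVneq x y) => [->|_] /=.
    by rewrite fy; apply/esym/negbTE/Lfib.
  apply: andb_idr => xL; have [j jJ ->] := lifts_mem fL xL.
  by apply: contraNneq iJ => -[<-].
move=> y z; rewrite !inE => /Lfib yL _ /setP/(_ y).
by rewrite !inE eqxx (negbTE yL) !orbF /= => /esym/eqP.
Qed.

End Lifts.

(** A lift [K] of [I] along a composite determines the intermediate set [J], which
    must be the image of [K] under [g]: its cardinality lies between those of [I]
    and [K], which are equal. *)
Lemma big_lifts_comp (X Y Z : finType) (M : nmodType) (F : {set X} -> M)
    (f : Y -> option Z) (g : X -> option Y) (I : {set Z}) :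
  \sum_(J | lifts f I J) \sum_(K | lifts g J K) F K
  = \sum_(K | lifts (pcomp f g) I K) F K.
Proof.
pose h (K : {set X}) := [set y | Some y \in g @: K].
have imE (K : {set X}) : pcomp f g @: K = obind f @: (g @: K).
  by rewrite -imset_comp; apply: eq_imset.
have imS (J : {set Y}) : obind f @: (Some @: J) = f @: J.
  by rewrite -imset_comp; apply: eq_imset.
have hE (J : {set Y}) K : lifts g J K -> h K = J.
  case/andP=> _ /eqP gK; apply/setP=> y; rewrite inE gK mem_imset //.
  exact: Some_inj.
have hP K : lifts (pcomp f g) I K -> lifts g (h K) K /\ lifts f I (h K).
  move=> fgK; have gK : g @: K = Some @: h K.
    apply/setP=> -[y|]; first by rewrite mem_imset ?inE //; apply: Some_inj.
    apply/imsetP/imsetP => [[x xK gx]|[]//].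
    by have [i _] := lifts_mem fgK xK; rewrite /pcomp -gx.
  case/andP: fgK => /eqP cK; rewrite imE gK imS => /eqP fhK.
  have chK : #|h K| = #|g @: K| by rewrite gK card_imset //; apply: Some_inj.
  have leK := leq_imset_card g K; have lehK := leq_imset_card f (h K).
  rewrite fhK (card_imset _ Some_inj) in lehK.
  by rewrite /lifts gK fhK !eqxx !andbT; split; apply/eqP; lia.
rewrite [RHS](partition_big h (lifts f I)) => [|K /hP[]//].
apply: eq_bigr => J fJ; apply: eq_bigl => K; apply/idP/andP => [gK|[]].
  split; last by rewrite (hE _ _ gK).
  case/andP: fJ => /eqP cJ /eqP fJ; case/andP: gK => /eqP cK /eqP gK.
  by rewrite /lifts cK cJ eqxx imE gK imS fJ /=.
by move=> /hP[gK _] /eqP <-.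
Qed.

(** Along the partial inverse of an injection [h] there is exactly one lift,
    the direct image: pullback along it is pushforward along [h]. *)
Lemma lifts_section (X Y : finType) (h : Y -> X) (g : X -> option Y)
    (J : {set Y}) (K : {set X}) : pcancel h g -> ocancel g h ->
  lifts g J K = (K == h @: J).
Proof.
move=> hK gK; have h_inj : injective h := pcan_inj hK.
apply/idP/eqP => [gJK|->].
  apply/eqP; rewrite eqEcard card_imset // (lifts_card gJK) leqnn andbT.
  apply/subsetP=> x /(lifts_mem gJK)[i iJ gx]; apply/imsetP; exists i => //.
  by have := gK x; rewrite gx.
by rewrite /lifts card_imset // -imset_comp (eq_imset _ hK) !eqxx.
Qed.

(** * Pullback of hypergraphs *)

Section WedgeSums.
Variable V : lmodType rat.

Fact wedge_linearl (y : V) : linear (fun x => wedge x y).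
Proof.
move=> a x x'; rewrite /wedge (tens_linearl y a x x') (tens_linearr y a x x').
by rewrite scalerBr opprD addrACA.
Qed.

Fact wedge_linearr (x : V) : linear (fun y => wedge x y).
Proof.
by move=> a y y'; rewrite wedgeC wedge_linearl opprD -scalerN -!wedgeC.
Qed.

HB.instance Definition _ x := GRing.isLinear.Build rat V (tensor V V) _
  (@wedge V x) (wedge_linearr x).

Lemma wedge_suml (T : Type) (r : seq T) (P : pred T) (F : T -> V) (y : V) :
  wedge (\sum_(i <- r | P i) F i) y = \sum_(i <- r | P i) wedge (F i) y.
Proof.
rewrite wedgeC raddf_sum -sumrN.
by apply: eq_bigr => i _; rewrite [RHS]wedgeC.
Qed.

End WedgeSums.

Section Pullback.
Variable k : nat.

Section HGlinLinear.
Variables (n : nat) (M : lmodType rat) (F : {set 'I_n} -> M).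

Fact HGlin_linear : linear (@HGlin k n M F).
Proof.
move=> a x y; rewrite /HGlin scaler_sumr -big_split.
by apply: eq_bigr => I _; rewrite !ffunE scalerDl scalerA.
Qed.

HB.instance Definition _ := GRing.isLinear.Build rat (HGspace k n) M _
  (@HGlin k n M F) HGlin_linear.

End HGlinLinear.

Lemma hg_eq0 n (I : {set 'I_n}) : #|I| != k -> hg k I = 0.
Proof.
move=> Ik; apply/ffunP=> J; rewrite !ffunE; case: eqP => // JI.
by case/negP: Ik; rewrite -JI; apply: (valP J).
Qed.

Lemma hg_decomp n (x : HGspace k n) :
  x = \sum_(I : hyperedge k n) (x I : rat) *: hg k (val I).
Proof.
apply/ffunP=> J; rewrite sum_ffunE (bigD1 J) //= !ffunE eqxx big1 => [|I IJ].
  by rewrite addr0 [_ *: _]mulr1.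
by rewrite !ffunE (inj_eq val_inj) eq_sym (negbTE IJ) scaler0.
Qed.

(** A lift of [I] has as many elements as [I]: the terms are basis vectors when
    [#|I| = k], and vanish otherwise, as [hg k I] does. *)
Definition pull n N (f : 'I_N -> option 'I_n) : HGspace k n -> HGspace k N :=
  HGlin (fun I => \sum_(K | lifts f I K) hg k K).

HB.instance Definition _ n N (f : 'I_N -> option 'I_n) :=
  GRing.Linear.copy (pull f) (HGlin (fun I => \sum_(K | lifts f I K) hg k K)).

Lemma pull_hg n N (f : 'I_N -> option 'I_n) (I : {set 'I_n}) :
  pull f (hg k I) = \sum_(K | lifts f I K) hg k K.
Proof.
have [/eqP Ik|Ik] := boolP (#|I| == k); first exact: HGlin_hg.
rewrite (hg_eq0 Ik) raddf0 big1 // => K fK.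
by rewrite hg_eq0 // (lifts_card fK).
Qed.

Lemma hg_ext n (M : lmodType rat) (f g : {linear HGspace k n -> M}) :
  (forall I : {set 'I_n}, f (hg k I) = g (hg k I)) -> f =1 g.
Proof.
move=> fg x; rewrite [x]hg_decomp !raddf_sum.
by apply: eq_bigr => I _; rewrite /= !linearZ fg.
Qed.

Lemma eq_pull n N (f g : 'I_N -> option 'I_n) : f =1 g -> pull f =1 pull g.
Proof.
move=> fg; apply: hg_ext => I; rewrite /= !pull_hg.
by apply: eq_bigl => K; rewrite /lifts (eq_imset _ fg).
Qed.

Lemma pull_section n N (h : 'I_n -> 'I_N) (g : 'I_N -> option 'I_n) :
  pcancel h g -> ocancel g h ->
  pull g =1 HGlin (fun I => hg k (h @: I)).
Proof.
move=> hK gK x; apply: eq_bigr => I _; congr (_ *: _).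
rewrite (eq_bigl (pred1 (h @: val I))) ?big_pred1_eq // => K.
exact: lifts_section.
Qed.

Lemma pull_id n (x : HGspace k n) : pull Some x = x.
Proof.
rewrite (pull_section (h := id)) // [RHS]hg_decomp.
by apply: eq_bigr => I _; rewrite imset_id.
Qed.

Lemma pull_comp n m l (f : 'I_m -> option 'I_n) (g : 'I_l -> option 'I_m) x :
  pull g (pull f x) = pull (pcomp f g) x.
Proof.
rewrite -[LHS]/((pull g \o pull f) x); move: x; apply: hg_ext => I /=.
by rewrite !pull_hg raddf_sum -big_lifts_comp; apply: eq_bigr => J _; rewrite /= pull_hg.
Qed.

Lemma HGrel_sum n (T : Type) (r : seq T) (P : pred T)
    (F : T -> tensor (HGspace k n) (HGspace k n)) :
  (forall i, P i -> HGrel (F i)) -> HGrel (\sum_(i <- r | P i) F i).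
Proof. by move=> FP; apply: big_ind => // [|x y]; [apply: span0 | apply: spanD]. Qed.

Lemma HGrel_disjoint n (I J : {set 'I_n}) : [disjoint I & J] ->
  HGrel (wedge (hg k I) (hg k J)).
Proof.
move=> IJ; have [/eqP Ik|/hg_eq0 ->] := boolP (#|I| == k); last first.
  by rewrite wedgeC raddf0 oppr0; apply: span0.
have [/eqP Jk|/hg_eq0 ->] := boolP (#|J| == k); last by rewrite raddf0; apply: span0.
by apply: Defs.sub_span; left; exists I, J.
Qed.

(** The sum over [I] alone is a defining relation; each further point [y] of [S]
    contributes a wedge of disjoint hyperedges. *)
Lemma HGrel_star n (I J S : {set 'I_n}) : #|I| = k -> #|J| = k.-1 ->
  I \subset S -> [disjoint S & J] ->
  HGrel (wedge (hg k I) (\sum_(y in S) hg k (y |: J))).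
Proof.
move=> Ik Jk IS SJ; have IJ := disjointWl IS SJ.
rewrite (big_setID I) /= raddfD; apply: spanD.
  by apply: Defs.sub_span; right; exists I, J; rewrite (setIidPr IS).
rewrite raddf_sum; apply: HGrel_sum => y; rewrite !inE => /andP[yI yS].
apply: HGrel_disjoint; rewrite -setI_eq0 setIUr setU_eq0 !setI_eq0 IJ andbT.
by rewrite disjoint_sym disjoints1.
Qed.

(** Wedges of disjoint hyperedges pull back to sums of such wedges.  For the other
    relations, group the terms by the lift [K] of [I] and the lift [L] of [J]: each
    group is an instance of [HGrel_star], [S] being the set of points over [I]. *)
Lemma pull_rel n N (f : 'I_N -> option 'I_n) r :
  HGrel r -> HGrel (tmap (pull f : {linear HGspace k n -> HGspace k N})
                         (pull f : {linear HGspace k n -> HGspace k N}) r).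
Proof.
apply: span_tmap; first exact: span_submodule.
move=> _ [[I [J [Ik Jk IJ ->]]]|[I [J [Ik Jk IJ ->]]]]; rewrite tmap_wedge /=.
  rewrite !pull_hg wedge_suml; apply: HGrel_sum => K fK; rewrite raddf_sum.
  by apply: HGrel_sum => L fL; apply/HGrel_disjoint/(lifts_disjoint fK fL).
rewrite pull_hg wedge_suml; apply: HGrel_sum => K fK.
rewrite [pull f (\sum_(i in I) _)]raddf_sum (eq_bigr (fun i => \sum_(L | lifts f J L)
    \sum_(y | f y == Some i) hg k (y |: L))) => [|i iI]; last first.
  by rewrite /= pull_hg big_lifts_setU1 // (disjointFr IJ iI).
rewrite exchange_big raddf_sum; apply: HGrel_sum => L fL.
rewrite (exchange_big_dep (mem [set y | f y \in Some @: I])) /= => [|i y iI /eqP fy].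
  rewrite (eq_bigr (fun y => hg k (y |: L))) => [|y]; last first.
    rewrite inE => /imsetP[i iI fy]; rewrite (eq_bigl (pred1 i)) ?big_pred1_eq // => j.
    rewrite /= fy (inj_eq Some_inj) eq_sym.
    by case: eqP => [->|]; rewrite ?andbF // iI.
  apply: HGrel_star.
  - by rewrite (lifts_card fK).
  - by rewrite (lifts_card fL).
  - by apply/subsetP=> x /(lifts_mem fK)[i iI fx]; rewrite inE fx imset_f.
  - apply/pred0P=> y /=; rewrite inE; apply/negP=> /andP[/imsetP[i iI fy]].
    move=> /(lifts_mem fL)[j jJ]; rewrite fy => -[ij].
    by rewrite -ij (disjointFr IJ iI) in jJ.
by rewrite inE fy imset_f.
Qed.

Definition QDpull n N (f : 'I_N -> option 'I_n) : QDhom (HG k n) (HG k N) :=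
  @MkQDhom (HG k n) (HG k N) (pull f) (@pull_rel n N f).

End Pullback.

(** * The two parts of a partial composition *)

Section Uninner.
Variables (n m : nat) (p : 'I_n).
Implicit Types (x : 'I_(n + m).-1) (j : 'I_m).

Definition uninner x : option 'I_m :=
  if (p <= x)%N then insub (x - p)%N else None.

Variant uninner_spec x : option 'I_m -> Type :=
  | UninnerSome j of x = (p + j)%N :> nat : uninner_spec x (Some j)
  | UninnerNone of ~~ (p <= x < p + m)%N : uninner_spec x None.

Lemma uninnerP x : uninner_spec x (uninner x).
Proof.
rewrite /uninner; case: leqP => px; last by apply: UninnerNone; lia.
case: insubP => [j _ /= jE|xm]; first by apply: UninnerSome; lia.
by apply: UninnerNone; lia.
Qed.

Lemma inner_uninnerK : pcancel (inner p) uninner.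
Proof.
move=> j; have := ltn_ord j; case: uninnerP => /= [i ij _|]; last by lia.
by congr Some; apply: val_inj => /=; lia.
Qed.

Lemma uninner_innerK : ocancel uninner (inner p).
Proof. by move=> x; case: uninnerP => //= j xj; apply: val_inj. Qed.

Lemma uninner_collapse x j : uninner x = Some j -> collapse p x = p.
Proof.
move=> xj; have := uninner_innerK x; rewrite xj /= => <-.
exact: collapse_inner.
Qed.

End Uninner.

Section Composition.
Variable k : nat.
Hypothesis k_gt0 : (0 < k)%N.

Definition circ_pull n m (p : 'I_n) (u : HGspace k n * HGspace k m) :
    HGspace k (n + m).-1 :=
  pull (Some \o @collapse n m p) u.1 + pull (@uninner n m p) u.2.

Fact circ_pull_linear n m p : linear (@circ_pull n m p).
Proof. by move=> a u v; rewrite /circ_pull !linearP scalerDr addrACA. Qed.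

HB.instance Definition _ n m p := GRing.isLinear.Build rat
  (HGspace k n * HGspace k m)%type (HGspace k (n + m).-1) _
  (@circ_pull n m p) (@circ_pull_linear n m p).

(** If [p] is not in [I], the lifts of [I] avoid the inserted block, hence avoid
    the image [L] of [J].  If [p] is in [I], the lifts of [I] are the sets [y |: K]
    with [K] a lift of [I :\ p] and [y] an arbitrary point of the block, which
    contains [L]: this is [HGrel_star] with the roles of [I] and [J] exchanged. *)
Lemma circ_mixed n m (p : 'I_n) (x : HGspace k n) (y : HGspace k m) :
  HGrel (wedge (pull (Some \o @collapse n m p) x) (pull (@uninner n m p) y)).
Proof.
rewrite [x]hg_decomp [y]hg_decomp.
rewrite [pull _ (\sum_(i : hyperedge k n) _)]raddf_sum.
rewrite [pull _ (\sum_(i : hyperedge k m) _)]raddf_sum.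
rewrite wedge_suml; apply: HGrel_sum => I _; rewrite raddf_sum.
apply: HGrel_sum => J _; rewrite /= !linearZ /= wedgeC linearZ -scalerN -wedgeC.
do 2!apply: spanZ; rewrite !pull_hg raddf_sum; apply: HGrel_sum => L uL.
rewrite /= wedge_suml.
have [/eqP Ik /eqP Jk] := (valP I, valP J).
have Lp y' : y' \in L -> collapse p y' = p.
  by move=> /(lifts_mem uL)[j _]; apply: uninner_collapse.
have [pI|pI] := boolP (p \in val I); last first.
  apply: HGrel_sum => K cK; apply: HGrel_disjoint.
  apply/pred0P=> z /=; apply/negP=> /andP[/(lifts_mem cK)[i iI [zi]] /Lp zp].
  by rewrite -zp zi iI in pI.
rewrite -(setD1K pI) big_lifts_setU1 ?setD11 //.
apply: HGrel_sum => K cK; rewrite -wedge_suml wedgeC.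
rewrite -scaleN1r; apply: spanZ.
rewrite (eq_bigl (mem [set z | @collapse n m p z == p])) => [|z]; last by rewrite /= inE.
apply: HGrel_star.
- by rewrite (lifts_card uL).
- by rewrite (lifts_card cK); have := cardsD1 p (val I); rewrite Ik pI; lia.
- by apply/subsetP=> z /Lp zp; rewrite inE zp.
- apply/pred0P=> z /=; rewrite inE; apply/negP=> /andP[/eqP zp].
  move=> /(lifts_mem cK)[i]; rewrite /= !inE zp => /andP[ip _] [pi].
  by rewrite pi eqxx in ip.
Qed.

Fact circ_pull_subproof n m (p : 'I_n) r :
  @qd_rel (QDsum (HG k n) (HG k m)) r ->
  @qd_rel (HG k (n + m).-1) (tmap (@circ_pull n m p) (@circ_pull n m p) r).
Proof.
apply: (@QDsum_homP (HG k n) (HG k m) (HG k (n + m).-1) (@circ_pull n m p)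
  (QDpull k (Some \o @collapse n m p)) (QDpull k (@uninner n m p))).
- by move=> x; rewrite /= /circ_pull /= raddf0 addr0.
- by move=> y; rewrite /= /circ_pull /= raddf0 add0r.
- exact: circ_mixed.
Qed.

Definition QDcirc n m (p : 'I_n) :
    QDhom (QDsum (HG k n) (HG k m)) (HG k (n + m).-1) :=
  @MkQDhom (QDsum (HG k n) (HG k m)) (HG k (n + m).-1) (@circ_pull n m p)
    (@circ_pull_subproof n m p).

End Composition.

(** * The operad axioms as equations between partial maps *)

Section Associativity.

(** [collapse] as a disjunction of linear constraints, in which nested collapses
    stay opaque to linear arithmetic. *)
Lemma collapse_val n m (p : 'I_n) (x : 'I_(n + m).-1) :
  (x < p)%N /\ collapse p x = x :> nat \/
  (p <= x < p + m)%N /\ collapse p x = p :> nat \/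
  (p + m <= x)%N /\ (collapse p x + m)%N = x.+1.
Proof. by rewrite /=; case: ltnP => ?; last case: ltnP => ?; lia. Qed.

(* In the two sections below, x and y are the same position in the two arities
   that the associativity axioms identify.  There is one equation for each of
   the three operations being composed. *)
Section Sequential.
Variables (l m n : nat) (i : 'I_l) (j : 'I_m).
Variables (x : 'I_((l + m).-1 + n).-1) (y : 'I_(l + (m + n).-1).-1).
Hypothesis xy : x = y :> nat.

Let ijE : inner i j = (i + j)%N :> nat. Proof. by []. Qed.
Let j_lt : (j < m)%N := ltn_ord j.
Let cx := collapse_val (inner i j) x.

Lemma collapse_collapse_seq : collapse i (collapse (inner i j) x) = collapse i y.
Proof.
apply: ord_inj.
have := collapse_val i (collapse (inner i j) x); have := collapse_val i y.
by move: xy ijE j_lt cx; lia.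
Qed.

Lemma uninner_collapse_seq :
  uninner i (collapse (inner i j) x) = omap (@collapse m n j) (uninner i y).
Proof.
move: xy ijE j_lt cx => ? ? ? ?.
case: uninnerP => [a|] xa; case: uninnerP => [b|] yb //=.
- congr Some; apply: ord_inj.
  by have := collapse_val j b; lia.
- by have := ltn_ord a; lia.
- by have := ltn_ord b; lia.
Qed.

Lemma uninner_uninner_seq :
  uninner (inner i j) x = obind (@uninner m n j) (uninner i y).
Proof.
move: xy ijE j_lt => ? ? ?.
case: uninnerP => [a|] xa; case: uninnerP => [b|] yb //=.
- case: uninnerP => [c|] bc; last by have := ltn_ord a; lia.
  by congr Some; apply: val_inj => /=; lia.
- by have := ltn_ord a; lia.
- by case: uninnerP => // c; have := ltn_ord c; lia.
Qed.

End Sequential.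

Section Parallel.
Variables (l m n : nat) (i k : 'I_l) (ik : (i < k)%N).
Variables (x : 'I_((l + m).-1 + n).-1) (y : 'I_((l + n).-1 + m).-1).
Hypothesis xy : x = y :> nat.

Let kE : par_pos_gt m ik = (k + m).-1 :> nat. Proof. by []. Qed.
Let iE : par_pos_lt n ik = i :> nat. Proof. by []. Qed.
Let cx := collapse_val (par_pos_gt m ik) x.
Let cy := collapse_val (par_pos_lt n ik) y.

Lemma collapse_collapse_par :
  collapse i (collapse (par_pos_gt m ik) x)
  = collapse k (collapse (par_pos_lt n ik) y).
Proof.
apply: ord_inj.
have := collapse_val i (collapse (par_pos_gt m ik) x).
have := collapse_val k (collapse (par_pos_lt n ik) y).
by move: xy ik kE iE cx cy; lia.
Qed.

Lemma uninner_collapse_gt :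
  uninner i (collapse (par_pos_gt m ik) x) = uninner (par_pos_lt n ik) y.
Proof.
move: xy (ik) kE iE cx cy => ? ? ? ? ? ?.
case: uninnerP => [a|] xa; case: uninnerP => [b|] yb //=.
- by congr Some; apply: val_inj => /=; have := ltn_ord b; lia.
- by have := ltn_ord a; lia.
- by have := ltn_ord b; lia.
Qed.

Lemma uninner_collapse_lt :
  uninner (par_pos_gt m ik) x = uninner k (collapse (par_pos_lt n ik) y).
Proof.
move: xy (ik) kE iE cx cy => ? ? ? ? ? ?.
case: uninnerP => [a|] xa; case: uninnerP => [b|] yb //=.
- by congr Some; apply: val_inj => /=; have := ltn_ord b; lia.
- by have := ltn_ord a; lia.
- by have := ltn_ord b; lia.
Qed.

End Parallel.

Lemma uninner_block_perm n m (p : 'I_n) (s : 'S_n) (t : 'S_m)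
    (x : 'I_(n + m).-1) :
  uninner (s p) (block_perm p s t x) = omap t (uninner p x).
Proof.
have [[j ->]|[xp _ px]] := collapseP p x.
  by rewrite block_perm_inner !inner_uninnerK.
rewrite {2}/uninner px; case Ey: (uninner _ _) => [j|] //.
move/uninner_collapse: Ey; rewrite collapse_block_perm => /perm_inj.
by move/xp.
Qed.

End Associativity.

(** * The operad *)

Section Operad.
Variable k : nat.
Hypothesis k_gt0 : (0 < k)%N.

Definition QDperm n (s : 'S_n) : QDhom (HG k n) (HG k n) :=
  QDpull k (Some \o (s^-1)%g).

Lemma HGpermE n (s : 'S_n) (x : HGspace k n) : pull (Some \o (s^-1)%g) x = HGperm s x.
Proof. by apply: pull_section => y /=; rewrite ?permK ?permKV. Qed.

(** The definition of [HGcirc] spells out injectivity on [K], which equality of the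
    cardinalities of [K] and of its image provides. *)
Lemma HGcircE n m (p : 'I_n) (u : HGspace k n * HGspace k m) :
  circ_pull p u = HGcirc p u.
Proof.
congr (_ + _); last exact: pull_section (inner_uninnerK p) (uninner_innerK p) u.2.
apply: eq_bigr => I _; congr (_ *: _); apply: eq_bigl => K.
have [/eqP Ik] := valP I; rewrite /lifts Ik imset_comp (inj_eq (imset_inj Some_inj)).
case: eqP => //= Kk; case: eqP => [KI|_]; rewrite ?andbF // andbT.
by apply/esym/dinjectiveP/imset_injP; rewrite KI Ik Kk.
Qed.

Lemma arity_castE n n' (e : n = n') (x : HGspace k n) :
  (arity_cast (HG k : nat -> QDcat) e : QDhom (HG k n) (HG k n')) x
  = pull (Some \o cast_ord (esym e)) x.
Proof.
case: n' / e => /=; rewrite -[LHS]pull_id; apply: eq_pull => y /=.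
by rewrite cast_ord_id.
Qed.

Fact unit_subproof r : @qd_rel QD0 r -> @qd_rel (HG k 1) (tmap \0 \0 r).
Proof. by rewrite (tensor_qd0 r) raddf0 => _; apply: span0. Qed.

Definition QDunit : QDhom QD0 (HG k 1) := MkQDhom unit_subproof.

(** Arity casts and identities are pullbacks too, along bijections and along
    [Some]: after [pull_comp], each summand of the source of an axiom carries one
    pullback on either side. *)
Definition HGoperad : @operad_on QDm (HG k).
Proof.
refine (@OperadOn QDm (HG k) QDperm (QDcirc k_gt0) QDunit _ _ _ _ _ _ _).
- move=> n; apply: QDhom_ext => x /=; rewrite -[RHS]pull_id.
  by apply: eq_pull => y /=; rewrite invg1 perm1.
- move=> n s t; apply: QDhom_ext => x /=; rewrite pull_comp.
  by apply: eq_pull => y; rewrite /pcomp /= invMg permM.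
- move=> n m p s t; apply: QDhom_ext => -[x y] /=.
  rewrite /lpair /circ_pull raddfD /= !pull_comp; congr (_ + _).
    apply: eq_pull => z; rewrite /pcomp /=; congr Some.
    by rewrite -{1}(permKV (block_perm p s t) z) collapse_block_perm permK.
  apply: eq_pull => z; rewrite /pcomp /=.
  rewrite -{1}(permKV (block_perm p s t) z) uninner_block_perm.
  by case: uninner => //= j; rewrite permK.
- move=> l m n i j; apply: QDhom_ext => -[[x y] z] /=.
  rewrite arity_castE /lpair /lassoc /circ_pull /= /circ_pull !raddfD /=.
  rewrite !pull_comp -addrA; congr (_ + (_ + _)); apply: eq_pull => a.
  + by congr Some; exact: collapse_collapse_seq.
  + exact: uninner_collapse_seq.
  + exact: uninner_uninner_seq.
- move=> l m n i j ij; apply: QDhom_ext => -[[x y] z] /=.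
  rewrite arity_castE /lpair /lassoc /lassoc_inv /circ_pull /= /circ_pull !raddfD /=.
  rewrite !pull_comp addrAC; congr (_ + _ + _); apply: eq_pull => a.
  + by congr Some; exact: collapse_collapse_par.
  + exact: uninner_collapse_lt.
  + exact: uninner_collapse_gt.
- move=> n; apply: QDhom_ext => -[x y] /=.
  rewrite /lpair /circ_pull /= raddf0 add0r -[RHS]pull_id; apply: eq_pull => a.
  have := ltn_ord a.
  case: uninnerP => [b|] /= ab; last by lia.
  by move=> _; apply: (congr1 (@Some _)); apply: val_inj.
- move=> n p; apply: QDhom_ext => -[x y] /=.
  rewrite arity_castE /lpair /circ_pull /= raddf0 addr0 pull_comp -[RHS]pull_id.
  apply: eq_pull => a; rewrite /pcomp /=; congr Some; apply: val_inj => /=.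
  by have := ltn_ord a; repeat case: ltnP => ?; lia.
Defined.

End Operad.

Theorem proposition5p19 (k : nat) (hk : (2 <= k)%N) :
  exists O : @operad_on QDm (HG k),
    (forall (n : nat) (s : 'S_n) (x : HGspace k n),
       (op_perm O s : QDhom (HG k n) (HG k n)) x = HGperm s x) /\
    (forall (n m : nat) (p : 'I_n) (u : (HGspace k n * HGspace k m)%type),
       (op_circ O m p : QDhom (QDsum (HG k n) (HG k m)) (HG k (n + m).-1)) u
       = HGcirc p u) /\
    (forall x : QD0, (op_unit O : QDhom QD0 (HG k 1)) x = 0%R).
Proof.
exists (HGoperad (ltnW hk)); split; first exact: HGpermE.
by split=> // n m p u; apply: HGcircE.
Qed.
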